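(* Let $A$ be a nonzero real symmetric positive semi-definite $n\times n$ matrix with eigenvalues $\lambda_1,\dots,\lambda_n$, and define $$\mathcal{K}_G^{j}:=\frac{\lambda_j}{tr(A)},\qquad \mathcal{K}_G:=\max_{1\le j\le n}\mathcal{K}_G^{j}=\frac{\|A\|}{tr(A)} .$$ Let $0<\varepsilon<1$ and $0<\delta<1$. Then the Gaussian trace estimator $tr_G^N(A)$ satisfies $$\Pr\left(\,|tr_G^N(A)-tr(A)|\le \varepsilon\, tr(A)\,\right)\ \ge\ 1-\delta$$ provided that the positive integer $N$ satisfies $$N\ge 8\,\varepsilon^{-2}\ln(2/\delta).$$ The same estimate also holds provided that $$N>8\,\mathcal{K}_G\,\varepsilon^{-2}\ln(2/\delta).$$
   Context: $tr(A)$ denotes the trace of $A$ and $\|A\|$ its spectral ($2$-)norm. The Gaussian estimator is $tr_G^N(A):=\frac1N\sum_{i=1}^N w_i^t A w_i$, where $w_1,\dots,w_N\in\mathbb{R}^n$ are independent random vectors whose components are all i.i.d. standard normal random variables. *)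

(* Defs.v *)
From HB Require Import structures.
From mathcomp Require Import all_boot all_order all_algebra.
From mathcomp Require Import all_classical all_reals all_analysis.

Set Implicit Arguments.
Unset Strict Implicit.
Unset Printing Implicit Defensive.

Import Order.TTheory GRing.Theory Num.Theory.
Import numFieldNormedType.Exports.

Local Open Scope classical_set_scope.
Local Open Scope ring_scope.

Definition qform (R : realType) n (A : 'M[R]_n) (x : 'cV[R]_n) : R :=
  (x^T *m A *m x) 0 0.

Definition psdmx (R : realType) n (A : 'M[R]_n) : Prop :=
  forall x : 'cV[R]_n, 0 <= qform A x.

(** The eigenvalues are listed with their algebraic multiplicities. *)
Definition is_eigenvalues (R : realType) n (A : 'M[R]_n) (lam : 'I_n -> R) :
    Prop :=
  char_poly A = \prod_(j < n) ('X - (lam j)%:P).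

(** The norm that MathComp-Analysis puts on matrices is the max norm, hence the
    explicit Euclidean norm and its induced operator norm. *)
Definition norm2 (R : realType) n (x : 'cV[R]_n) : R :=
  Num.sqrt (\sum_(i < n) x i 0 ^+ 2).

Definition spectral_norm (R : realType) n (A : 'M[R]_n) : R :=
  sup [set norm2 (A *m x) | x in [set x : 'cV[R]_n | norm2 x <= 1]].

Definition KGj (R : realType) n (A : 'M[R]_n) (lam : 'I_n -> R) (j : 'I_n) : R :=
  lam j / \tr A.

(** The default value 0 is harmless: when [A] is positive semi-definite and
    nonzero, [n] is positive and all the [KGj A lam j] are nonnegative. *)
Definition KG (R : realType) n (A : 'M[R]_n) (lam : 'I_n -> R) : R :=
  \big[Num.max/0]_(j < n) KGj A lam j.

Definition mutually_independent d (T : measurableType d) (R : realType)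
    (P : probability T R) (I : finType) (X : I -> {RV P >-> R}) : Prop :=
  forall (J : {set I}) (B : I -> set R), (forall i, measurable (B i)) ->
    P (\bigcap_(i in [set i | i \in J]) (X i @^-1` B i)) =
    (\prod_(i in J) P (X i @^-1` B i))%E.

(** A measure is only meaningful on measurable sets, so that equality of the
    laws is required there only. *)
Definition standard_normal d (T : measurableType d) (R : realType)
    (P : probability T R) (X : {RV P >-> R}) : Prop :=
  forall B : set R, measurable B -> distribution P X B = normal_prob 0 1 B.

(** [w i j] is the [j]-th component of the [i]-th random vector; independence
    is that of the whole family of [N * n] components. *)
Definition iid_standard_normal d (T : measurableType d) (R : realType)
    (P : probability T R) N n (w : 'I_N -> 'I_n -> {RV P >-> R}) : Prop :=
  (forall i j, standard_normal (w i j)) /\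
  mutually_independent (fun k : 'I_N * 'I_n => w k.1 k.2).

Definition gaussian_trace_estimator d (T : measurableType d) (R : realType)
    (P : probability T R) N n (w : 'I_N -> 'I_n -> {RV P >-> R})
    (A : 'M[R]_n) (t : T) : R :=
  N%:R^-1 * \sum_(i < N) qform A (\col_(j < n) w i j t).

(* Main.v *)
Require Import Defs.
From HB Require Import structures.
From mathcomp Require Import all_boot all_order all_algebra.
From mathcomp Require Import all_classical all_reals all_analysis.
From mathcomp Require Import measurable_realfun complex ring lra.

(** The proof is a Chernoff bound, with the moment generating function of the
    quadratic form computed from the characteristic polynomial of [A] rather
    than by diagonalizing the Gaussian vectors.

    For a symmetric [B] with [1 - B] positive definite and a standard normal
    vector [x], one has E exp(x^T B x / 2) = det(1 - B)^(-1/2).  This is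
    Gaussian elimination in disguise: integrating out the first coordinate
    of [x] completes a square ([integral_normal_expR]) and leaves a quadratic
    form in the other coordinates, whose matrix is such that [1 - eliminate B] is
    the Schur complement of the pivot of [1 - B]; the determinant loses the pivot
    at each step ([det_eliminate], [integrate_out_qform]).  Neither the
    rotation invariance of the normal law nor a product measure on R^n is
    involved: independence only enters through [integrate_out], which integrates
    a single variable against the sigma-algebra of all the others.  The induction
    carries a factor that depends on variables not yet integrated, so the same
    lemma treats the [N] vectors one after the other
    ([integral_prod_expR_qform]).

    With B = 2 s A the determinant is the product of the 1 - 2 s lam_j
    ([det_eigen]).  Since exp(- u - u^2) <= 1 - u when |u| <= 1/2
    ([expR_le_1Bx]), the log-moment generating function of the sum of the [N]
    quadratic forms is at most N (s tr A + 2 s^2 tr(A^2)), and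
    tr(A^2) <= K tr A for K the largest eigenvalue.  Taking s = eps / (4 K), or its opposite for the lower tail,
    bounds each tail by exp(- N eps^2 tr A / (8 K)), which is at most delta / 2
    under the second condition on [N]; the first condition is stronger,
    because K <= tr A.

    The largest eigenvalue is the spectral norm because unit eigenvectors attain it
    ([unit_eigenvector]) and the spectral theorem, applied over the complex
    numbers, shows that nothing exceeds it ([eigen_norm_le]). *)

Set Implicit Arguments.
Unset Strict Implicit.
Unset Printing Implicit Defensive.

Import Order.TTheory GRing.Theory Num.Theory.
Import numFieldNormedType.Exports.

Local Open Scope classical_set_scope.
Local Open Scope ring_scope.

(** * Euclidean norm and eigenvalues of a symmetric matrix *)

Lemma norm2_ge0 (R : realType) n (x : 'cV[R]_n) : 0 <= norm2 x.
Proof. exact: sqrtr_ge0. Qed.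

Lemma norm2_sqr (R : realType) n (x : 'cV[R]_n) :
  norm2 x ^+ 2 = \sum_i x i 0 ^+ 2.
Proof. by rewrite sqr_sqrtr// sumr_ge0// => i _; exact: sqr_ge0. Qed.

Lemma norm2_sqr_mul (R : realType) n (x : 'cV[R]_n) :
  norm2 x ^+ 2 = (x^T *m x) 0 0.
Proof. by rewrite norm2_sqr mxE; apply: eq_bigr => i _; rewrite mxE expr2. Qed.

Lemma norm2_eq0 (R : realType) n (x : 'cV[R]_n) : (norm2 x == 0) = (x == 0).
Proof.
apply/eqP/eqP => [x0|->]; last first.
  by rewrite /norm2 big1 ?sqrtr0// => i _; rewrite mxE expr0n.
have /eqP := norm2_sqr x; rewrite x0 expr0n eq_sym/= psumr_eq0; last first.
  by move=> i _; exact: sqr_ge0.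
move=> /allP x0'; apply/colP => i; rewrite mxE.
by apply/eqP; have := x0' i; rewrite mem_index_enum sqrf_eq0; exact.
Qed.

Lemma norm2Z (R : realType) n a (x : 'cV[R]_n) : norm2 (a *: x) = `|a| * norm2 x.
Proof.
rewrite /norm2; under eq_bigr do rewrite mxE exprMn.
by rewrite -mulr_sumr sqrtrM ?sqr_ge0// sqrtr_sqr.
Qed.

Section eigen.
Variables (R : realType) (n : nat) (A : 'M[R]_n) (lam : 'I_n -> R).
Hypotheses (A_sym : A \is symmetricmx) (lamP : is_eigenvalues A lam).

Lemma symmetricmx_tr : A^T = A.
Proof.
move: A_sym => /is_hermitianmxP.
by rewrite expr0 scale1r map_mx_id.
Qed.

Lemma unit_eigenvector j : exists2 x : 'cV[R]_n, norm2 x = 1 & A *m x = lam j *: x.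
Proof.
have : eigenvalue A (lam j).
  rewrite eigenvalue_root_char lamP /root horner_prod prodf_seq_eq0.
  apply/hasP; exists j; first exact: mem_index_enum.
  by rewrite hornerXsubC subrr eqxx.
move=> /eigenvalueP[v vA v0].
have vn0 : norm2 v^T != 0.
  by rewrite norm2_eq0; apply: contra v0 => /eqP vT0; rewrite -[v]trmxK vT0 trmx0.
exists ((norm2 v^T)^-1 *: v^T).
  by rewrite norm2Z gtr0_norm ?mulVf// invr_gt0 lt_def vn0 norm2_ge0.
by rewrite -scalemxAr -{1}symmetricmx_tr -trmx_mul vA linearZ/= scalerA mulrC -scalerA.
Qed.

Lemma eigen_ge0 j : psdmx A -> 0 <= lam j.
Proof.
move=> A_psd; have [x x1 Ax] := unit_eigenvector j; have := A_psd x.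
by rewrite /qform -mulmxA Ax -scalemxAr mxE -norm2_sqr_mul x1 expr1n mulr1.
Qed.

Lemma trace_eigen : \tr A = \sum_j lam j.
Proof.
case: n A lam lamP => [|m] B l lP; first by rewrite big_ord0 /mxtrace big_ord0.
apply: oppr_inj; rewrite -char_poly_trace// lP.
have sz : size [seq l j | j <- index_enum 'I_m.+1] = m.+1.
  by rewrite size_map /index_enum -enumT size_enum_ord.
rewrite -(big_map l xpredT (fun x => 'X - x%:P)).
by rewrite -[X in _`_X]/(m.+1.-1) -[X in X.-1]sz coefPn_prod_XsubC ?sz// big_map.
Qed.

(** For nonzero [s] this is the value of the characteristic polynomial at [s^-1],
    scaled by [s ^+ n]. *)
Lemma det_eigen s : \det (1%:M - s *: A) = \prod_j (1 - s * lam j).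
Proof.
have [->|s0] := eqVneq s 0.
  by rewrite scale0r subr0 det1 big1// => j _; rewrite mul0r subr0.
have -> : 1%:M - s *: A = s *: (s^-1%:M - A).
  by rewrite scalerBr scale_scalar_mx mulfV.
have -> : \det (s *: (s^-1%:M - A)) = s ^+ n * (char_poly A).[s^-1].
  rewrite detZ; congr (_ * _).
  rewrite /char_poly -horner_evalE -det_map_mx; congr (\det _).
  apply/matrixP => i j; rewrite !mxE /= /horner_eval.
  by rewrite hornerD hornerN hornerC hornerMn hornerX.
rewrite lamP horner_prod -[in s ^+ n](card_ord n) -prodr_const -big_split/=.
by apply: eq_bigr => j _; rewrite hornerXsubC mulrBr mulfV.
Qed.

(** In a complex orthonormal basis of eigenvectors [A] acts by multiplying each
    coordinate by some [lam k]; the unitary change of basis preserves the sum [sq]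
    of the squared moduli, which extends the squared Euclidean norm. *)
Lemma eigen_norm_le K (x : 'cV[R]_n) :
  0 <= K -> (forall j, 0 <= lam j <= K) ->
  norm2 (A *m x) <= K * norm2 x.
Proof.
move=> K0 lamK.
pose toC : {rmorphism R -> R[i]} := real_complex R.
pose B : 'M[R[i]]_n := map_mx toC A.
have B_norm : B \is normalmx.
  apply: symmetric_normalmx.
    apply/is_hermitianmxP; rewrite expr0 scale1r map_mx_id//.
    by apply/matrixP => i j; rewrite !mxE -{2}symmetricmx_tr mxE.
  by apply/mxOverP => i j; rewrite mxE; apply/complex_realP; exists (A i j).
pose P := spectralmx B; pose D := spectral_diag B.
have Pu : P \is unitarymx by exact: spectral_unitarymx.
have PU : P \in unitmx by exact: spectral_unit.
have BE : B = invmx P *m diag_mx D *m P by apply/orthomx_spectralP.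
(* The row vector [delta_mx 0 j *m P] is an eigenvector of [B]. *)
have Dlam j : exists k, D 0 j = toC (lam k).
  have : eigenvalue B (D 0 j).
    apply/eigenvalueP; exists (delta_mx 0 j *m P).
      rewrite BE !mulmxA mulmxK// scalemxAl; congr (_ *m _).
      rewrite mul_mx_diag; apply/rowP => k; rewrite !mxE eqxx/=.
      by have [->|_] := eqVneq k j; rewrite ?(mulr1, mul1r)// mul0r mulr0.
    apply/eqP => /(congr1 (mulmx^~ (invmx P))); rewrite mulmxK// mul0mx.
    by move/rowP => /(_ j); rewrite !mxE !eqxx => /eqP; rewrite oner_eq0.
  rewrite eigenvalue_root_char -map_char_poly lamP rmorph_prod /root horner_prod.
  rewrite prodf_seq_eq0 => /hasP[k _ /=].
  by rewrite map_polyXsubC hornerXsubC subr_eq0 => /eqP; exists k.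
pose sq (z : 'cV[R[i]]_n) := \sum_i `|z i 0| ^+ 2.
have sqE z : sq z = (map_mx Num.conj z^T *m z) 0 0.
  by rewrite mxE; apply: eq_bigr => i _; rewrite !mxE mulrC -normCK.
have sq_real (y : 'cV[R]_n) : sq (map_mx toC y) = toC (norm2 y ^+ 2).
  rewrite norm2_sqr rmorph_sum; apply: eq_bigr => i _; rewrite mxE.
  rewrite normc_def/= expr0n addr0 sqrtr_sqr -!rmorphXn/= -normrX.
  by rewrite ger0_norm ?sqr_ge0.
have sqP z : sq (P *m z) = sq z.
  rewrite !sqE trmx_mul map_mxM mulmxA -[_ *m _ *m P]mulmxA.
  by rewrite -map_trmx -invmx_unitary// mulVmx// mulmx1.
rewrite -(ler_pXn2r (n := 2))// ?nnegrE ?norm2_ge0 ?mulr_ge0 ?norm2_ge0//.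
rewrite exprMn -lecR.
have -> : ((K ^+ 2 * norm2 x ^+ 2)%:C = toC K ^+ 2 * toC (norm2 x ^+ 2))%C.
  by rewrite -rmorphXn -rmorphM.
rewrite -[leLHS]/(GRing.RMorphism.sort toC _) -!sq_real.
rewrite map_mxM -/B -[in leLHS]sqP BE !mulmxA mulmxV// mul1mx -mulmxA.
rewrite -(sqP (map_mx _ _)) /sq mulr_sumr; apply: ler_sum => i _.
rewrite mul_diag_mx mxE normrM exprMn ler_wpM2r ?exprn_ge0//.
have [k ->] := Dlam i; have /andP[l0 lK] := lamK k.
rewrite normc_def/= expr0n addr0 sqrtr_sqr ger0_norm//.
by rewrite -!rmorphXn/= lecR lerXn2r// nnegrE.
Qed.

(** Expand 0 <= |K x - A x|^2 and bound |A x| by K |x|. *)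
Lemma eigen_qform_le K (x : 'cV[R]_n) :
  0 < K -> (forall j, 0 <= lam j <= K) -> qform A x <= K * norm2 x ^+ 2.
Proof.
move=> K0 lamK; have AK := eigen_norm_le x (ltW K0) lamK.
have : 0 <= norm2 (K *: x - A *m x) ^+ 2 by exact: sqr_ge0.
have -> : norm2 (K *: x - A *m x) ^+ 2 =
    K ^+ 2 * norm2 x ^+ 2 - (K * qform A x) *+ 2 + norm2 (A *m x) ^+ 2.
  rewrite !norm2_sqr /qform -mulmxA mxE !mulr_sumr -sumrMnl -sumrB -big_split/=.
  by apply: eq_bigr => i _; rewrite !mxE; ring.
have : norm2 (A *m x) ^+ 2 <= (K * norm2 x) ^+ 2.
  by rewrite lerXn2r// nnegrE ?mulr_ge0 ?norm2_ge0// ltW.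
move=> h1 h2; rewrite -(ler_pM2l K0); move: h1 h2; rewrite exprMn mulr2n.
set a := norm2 _; set b := norm2 _; set c := qform _ _; nra.
Qed.
End eigen.

Section largest_eigenvalue.
Variables (R : realType) (n : nat) (A : 'M[R]_n) (lam : 'I_n -> R).
Hypotheses (A_sym : A \is symmetricmx) (lamP : is_eigenvalues A lam).
Hypotheses (A_psd : psdmx A) (A_neq0 : A != 0).

Let lam0 j : 0 <= lam j. Proof. exact: (eigen_ge0 A_sym lamP). Qed.

(** A zero trace would make all the eigenvalues, hence the operator norm, vanish. *)
Lemma trace_gt0 : 0 < \tr A.
Proof.
rewrite lt_def (trace_eigen lamP) sumr_ge0// andbT; apply: contra A_neq0.
rewrite psumr_eq0// => /allP lam_0; apply/eqP/matrixP => i j.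
have /eqP : norm2 (A *m delta_mx j 0) == 0.
  rewrite eq_le norm2_ge0 andbT.
  rewrite -[leRHS](mul0r (norm2 (delta_mx j 0 : 'cV_n))).
  apply: (eigen_norm_le A_sym lamP) => // k.
  by rewrite lam0 le_eqVlt (implyP (lam_0 k _))// mem_index_enum.
move/eqP; rewrite norm2_eq0 -colE => /eqP/colP/(_ i).
by rewrite !mxE.
Qed.

Lemma KG_bigmax : KG A lam = \big[Num.max/0]_j lam j / \tr A.
Proof.
rewrite /KG /KGj; apply: (big_ind2 (fun x y => x = y / \tr A)) => //.
  by rewrite mul0r.
by move=> x y u v -> ->; rewrite maxr_pMl// invr_ge0 ltW// trace_gt0.
Qed.

Lemma spectral_norm_bigmax : spectral_norm A = \big[Num.max/0]_j lam j.
Proof.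
set K := \big[_/_]_j _.
have lamK j : 0 <= lam j <= K by rewrite lam0 le_bigmax.
have K0 : 0 <= K by exact: bigmax_ge_id.
have ub : ubound [set norm2 (A *m x) | x in [set x : 'cV[R]_n | norm2 x <= 1]] K.
  move=> _ [x /= x1 <-]; apply: le_trans (eigen_norm_le A_sym lamP x K0 lamK) _.
  by rewrite ler_piMr.
apply/eqP; rewrite eq_le ge_sup//=; last first.
  exists (norm2 (A *m 0)), 0 => //=; rewrite /norm2 big1 ?sqrtr0 // => i _.
  by rewrite mxE expr0n.
have lam_le j : lam j <= spectral_norm A.
  have [x x1 Ax] := unit_eigenvector A_sym lamP j.
  apply: ub_le_sup; first by exists K.
  by exists x; rewrite /= ?x1// Ax norm2Z x1 mulr1 ger0_norm.
apply: bigmax_le => //.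
apply: ub_le_sup; first by exists K.
by exists 0; rewrite /= /norm2 ?mulmx0 big1 ?sqrtr0 // => i _; rewrite mxE expr0n.
Qed.

End largest_eigenvalue.

(** * Exponential moments of one normal variable *)

Section density.
Local Open Scope ereal_scope.
Import HBNNSimple.
Context d (T : measurableType d) (R : realType).
Variables (mu nu : {measure set T -> \bar R}) (g : T -> R).
Hypotheses (g_ge0 : forall x, (0 <= g x)%R) (mg : measurable_fun setT g).
Hypothesis nuE : forall B, measurable B -> nu B = \int[mu]_(x in B) (g x)%:E.

(** Both sides are limits along an increasing sequence of simple functions, and on
    indicators the identity is the hypothesis [nuE]. *)
Lemma ge0_integral_density (f : T -> \bar R) :
  (forall x, 0 <= f x) -> measurable_fun setT f ->
  \int[nu]_x f x = \int[mu]_x (f x * (g x)%:E).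
Proof.
move=> f0 mf; pose h := nnsfun_approx measurableT mf.
have hf x : (EFin \o h n) x @[n --> \oo] --> f x by exact: cvg_nnsfun_approx.
have hnd x : {homo (fun n => (h n x)%:E) : m n / (m <= n)%N >-> m <= n}.
  by move=> a b ab; rewrite lee_fin; exact/lefP/nd_nnsfun_approx.
have mh n : measurable_fun setT (EFin \o h n) by exact/measurable_EFinP.
have mgE : measurable_fun setT (EFin \o g) by exact/measurable_EFinP.
transitivity (limn (fun n => \int[nu]_x (h n x)%:E)).
  rewrite -monotone_convergence//; last by move=> n x _; rewrite lee_fin.
  by apply: eq_integral => x _; apply/esym/cvg_lim => //; exact: hf.
transitivity (limn (fun n => \int[mu]_x ((h n x)%:E * (g x)%:E))); last first.
  rewrite -monotone_convergence//.
  - apply: eq_integral => x _; apply/cvg_lim => //.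
    by apply: cvgeZr => //; exact: hf.
  - by move=> n; apply: emeasurable_funM; [exact: mh|exact: mgE].
  - by move=> n x _; rewrite mule_ge0// lee_fin.
  - by move=> x _ a b ab; rewrite lee_wpmul2r ?lee_fin//; exact: hnd.
congr (limn _); apply/funext => n.
have hE x : (h n x)%:E =
    \sum_(y \in range (h n)) (y * \1_(h n @^-1` [set y]) x)%:E.
  by rewrite fimfunE -fsumEFin.
have my y : measurable_fun setT (fun x => (y * \1_(h n @^-1` [set y]) x)%:E).
  by apply/measurable_EFinP; exact: measurable_funM.
transitivity (\sum_(y \in range (h n)) \int[nu]_x (y * \1_(h n @^-1` [set y]) x)%:E).
  under eq_integral do rewrite hE.
  rewrite ge0_integral_fsum// => y x _; exact: nnfun_muleindic_ge0.
transitivity (\sum_(y \in range (h n))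
    \int[mu]_x ((y * \1_(h n @^-1` [set y]) x)%:E * (g x)%:E)); last first.
  under [RHS]eq_integral => x _.
    rewrite hE ge0_mule_fsuml => [|y]; last exact: nnfun_muleindic_ge0.
    over.
  rewrite ge0_integral_fsum//.
  - by move=> y; apply: emeasurable_funM.
  - by move=> y x _; rewrite mule_ge0// ?lee_fin//; exact: nnfun_muleindic_ge0.
apply: eq_fsbigr => y; rewrite inE => -[x0 _ yE].
have y0 : (0 <= y)%R by rewrite -yE.
under eq_integral do rewrite EFinM.
rewrite ge0_integralZl//; last exact/measurable_EFinP/measurable_indic.
under [RHS]eq_integral do rewrite EFinM -muleA.
rewrite ge0_integralZl//; last 2 first.
- apply: emeasurable_funM => //; exact/measurable_EFinP/measurable_indic.
- by move=> x _; rewrite mule_ge0// lee_fin.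
congr (_ * _); rewrite integral_indic// setIT nuE//.
rewrite integral_mkcond; apply: eq_integral => x _.
by rewrite patchE indicE; case: ifPn; rewrite ?mul1e ?mul0e.
Qed.

End density.

Section one_normal_variable.
Variable R : realType.

(** Completing the square: an exponential of a quadratic polynomial turns the
    standard normal density into a multiple of another normal density. *)
Lemma normal_pdf_tilt (a b x : R) : a < 1 ->
  let s := (Num.sqrt (1 - a))^-1 in
  expR (a / 2 * x ^+ 2 + b * x) * normal_pdf 0 1 x =
  s * expR (b ^+ 2 / (1 - a) / 2) * normal_pdf (b / (1 - a)) s x.
Proof.
move=> a1 s; have a0 : 0 < 1 - a by rewrite subr_gt0.
have sn0 : s != 0 by rewrite invr_eq0 sqrtr_eq0 -ltNge.
have s2 : s ^+ 2 = (1 - a)^-1 by rewrite exprVn sqr_sqrtr// ltW.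
rewrite !normal_pdfE// ?oner_neq0// /normal_peak /normal_fun.
rewrite !expr1n mul1r s2.
have -> : Num.sqrt ((1 - a)^-1 * pi *+ 2) = s * Num.sqrt (pi *+ 2).
  by rewrite -mulrnAr sqrtrM ?invr_ge0 ?ltW// sqrtrV ?ltW.
set p := Num.sqrt (pi *+ 2).
have p0 : p != 0 by rewrite gt_eqF// sqrtr_gt0 mulrn_wgt0// pi_gt0.
transitivity (p^-1 * (expR (b ^+ 2 / (1 - a) / 2) *
    expR (- (x - b / (1 - a)) ^+ 2 / ((1 - a)^-1 *+ 2)))); last first.
  by field; rewrite p0 sn0.
rewrite mulrCA -!expRD; congr (_ * expR _).
by field; rewrite gt_eqF.
Qed.

Lemma integral_normal_expR (a b : R) : a < 1 ->
  (\int[normal_prob 0 1]_x (expR (a / 2 * x ^+ 2 + b * x))%:E =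
   ((Num.sqrt (1 - a))^-1 * expR (b ^+ 2 / (1 - a) / 2))%:E)%E.
Proof.
move=> a1; set s := (Num.sqrt (1 - a))^-1.
have s0 : 0 < s by rewrite invr_gt0 sqrtr_gt0 subr_gt0.
rewrite (@ge0_integral_density _ _ _ lebesgue_measure (normal_prob 0 1)
  (normal_pdf 0 1))//.
- under eq_integral do rewrite -EFinM normal_pdf_tilt// EFinM.
  rewrite ge0_integralZl//.
  + by rewrite integral_normal_pdf mule1.
  + by apply/measurable_EFinP; exact: measurable_normal_pdf.
  + by move=> x _; rewrite lee_fin normal_pdf_ge0.
- exact: normal_pdf_ge0.
- exact: measurable_normal_pdf.
- apply/measurable_EFinP; apply: measurableT_comp => //.
  apply: measurable_funD; first by apply: measurable_funM => //; exact: measurable_funX.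
  exact: measurable_funM.
Qed.

End one_normal_variable.

(** * Integrating out one variable of an independent family *)

Section independence.
Local Open Scope ereal_scope.
Context d (T : measurableType d) (R : realType) (P : probability T R).
Variables (I : finType) (X : I -> {RV P >-> R}).

(** These cylinders form a pi-system generating the sigma-algebra of all the
    variables but [X k].  Working with that sigma-algebra on [T] itself, through
    [g_sigma_algebraType], avoids a measurable structure on families of reals. *)
Definition cylinders_off (k : I) : set (set T) :=
  [set C | exists2 B : I -> set R, forall i, measurable (B i) &
    C = \bigcap_(i in [set i | i != k]) (X i @^-1` B i)].

Local Notation off k := (g_sigma_algebraType (cylinders_off k)).

Lemma measurable_preimage_RV (i : I) (B : set R) :
  measurable B -> measurable (X i @^-1` B).
Proof. by move=> mB; rewrite -[_ @^-1` _]setTI; exact: measurable_funP. Qed.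

Lemma cylinders_off_sub k : cylinders_off k `<=` d.-measurable.
Proof.
move=> _ [B mB ->]; apply: fin_bigcap_measurable => [|i _]; first exact: finite_finset.
exact: measurable_preimage_RV.
Qed.

Lemma measurable_offW k (C : set T) : measurable (C : set (off k)) -> d.-measurable C.
Proof.
move=> mC; apply: (smallest_sub (sigma_algebra_measurable _) _ mC).
exact: cylinders_off_sub.
Qed.

Lemma cylinders_off_setI k : setI_closed (cylinders_off k).
Proof.
move=> _ _ [B mB ->] [C mC ->]; exists (fun i => B i `&` C i).
  by move=> i; exact: measurableI.
by rewrite -bigcapI; apply: eq_bigcapr => i _; rewrite preimage_setI.
Qed.

Lemma cylinders_offT k : cylinders_off k setT.
Proof.
by exists (fun=> setT) => //; apply/seteqP; split => // x _ i _.
Qed.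

Lemma measurable_off k i : i != k -> measurable_fun setT (X i : off k -> R).
Proof.
move=> ik _ B mB; rewrite setTI; apply: sub_sigma_algebra.
exists (fun j => if j == i then B else setT); first by move=> j; case: ifP.
apply/seteqP; split => [x Bx j _ /=|x /(_ i ik)]; last by rewrite /= eqxx.
by case: eqP => // ->.
Qed.

Lemma measurable_id_off k : measurable_fun setT (idfun : T -> off k).
Proof. by move=> _ B mB; rewrite setTI preimage_id; apply: (@measurable_offW k). Qed.

Lemma measurable_fun_off k d' (U : measurableType d') (f : off k -> U) :
  measurable_fun setT f -> measurable_fun setT (f : T -> U).
Proof.
move=> mf; exact: (measurableT_comp mf (@measurable_id_off k)).
Qed.

Hypothesis indep : mutually_independent X.
Hypothesis X_std : forall i, standard_normal (X i).

(** Both sides are finite measures in [C] that agree on the cylinders. *)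
Lemma independent_off k (A : set R) (C : set (off k)) :
  measurable A -> measurable C ->
  P (X k @^-1` A `&` C) = normal_prob 0 1 A * P C.
Proof.
move=> mA mC; have mXA := measurable_preimage_RV k mA.
have pE : normal_prob 0 1 A = P (X k @^-1` A) by rewrite -(X_std k mA).
pose p := fine (P (X k @^-1` A)).
have p0 : (0 <= p)%R by exact: fine_ge0.
have PE : P (X k @^-1` A) = p%:E by rewrite fineK// fin_num_measure.
rewrite setIC -[LHS]/(mrestr P mXA C) pE PE -[RHS]/(mscale (NngNum p0) P C).
apply: (g_sigma_algebra_measure_unique (cylinders_off k) _ (fun=> setT)) => //.
- exact: cylinders_off_sub.
- by move=> _; exact: cylinders_offT.
- by rewrite bigcup_const.
- exact: cylinders_off_setI.
- move=> _ [B mB ->] /=; rewrite /mrestr /mscale/= -PE.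
  pose B' i := if i == k then A else B i.
  have mB' i : measurable (B' i) by rewrite /B'; case: ifP.
  have EC : \bigcap_(i in [set i | i != k]) X i @^-1` B i =
      \bigcap_(i in [set i | i \in [set~ k]%SET]) X i @^-1` B i.
    by congr (bigcap _ _); apply/seteqP; split => i /=; rewrite !inE.
  have EA : (\bigcap_(i in [set i | i != k]) X i @^-1` B i) `&` X k @^-1` A =
      \bigcap_(i in [set i | i \in [set: I]%SET]) X i @^-1` B' i.
    apply/seteqP; split => [x [Bx Ax] i _|x Bx].
      by rewrite /= /B'; case: eqP => [->//|/eqP ik]; exact: Bx.
    have {}Bx j : (X j @^-1` B' j) x by apply: Bx; rewrite /= inE.
    split => [i /= ik|]; first by have := Bx i; rewrite /= /B' (negbTE ik).
    by have := Bx k; rewrite /= /B' eqxx.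
  rewrite EA EC !indep// (bigD1 k)//= /B' eqxx; congr (_ * _).
  by apply: eq_big => [i|i]; rewrite !inE// => /negbTE ->.
- move=> _; rewrite -[ltLHS]/(P (setT `&` _)) setTI.
  by rewrite (le_lt_trans (probability_le1 _ mXA))// ltry.
Qed.

(** [normal_prob] is a measure on [measurableTypeR R], whose measurable sets are
    those of [R] but whose display is different. *)
Local Notation V := (measurableTypeR R).

Lemma measurable_RV_measurableTypeR k : measurable_fun setT (X k : T -> V).
Proof. by move=> mT B mB; exact: (measurable_funP (X k) mT B mB). Qed.

(** The joint law of [X k] and of the identity, seen as a map to [off k], is a
    product measure, so that Tonelli's theorem applies. *)
Lemma integrate_out k (f : V * off k -> \bar R) :
  measurable_fun setT f -> (forall z, 0 <= f z) ->
  \int[P]_t f (X k t, t) = \int[P]_t \int[normal_prob 0 1]_x f (x, t).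
Proof.
move=> mf f0.
have mX := @measurable_RV_measurableTypeR k; have mid := @measurable_id_off k.
pose phi (t : T) : V * off k := (X k t, t).
have mphi : measurable_fun setT phi by exact: measurable_fun_pair.
pose phi_mix := isMeasurableFun.Build _ _ _ _ _ mphi.
pose phiX : {mfun T >-> (V * off k)%type} := HB.pack phi phi_mix.
pose id_mix := isMeasurableFun.Build _ _ _ _ _ mid.
pose idX : {mfun T >-> off k} := HB.pack (idfun : T -> off k) id_mix.
pose N : probability V R := normal_prob 0 1.
pose Q : probability (off k) R := distribution P (idX : {RV P >-> off k}).
pose J : probability (V * off k)%type R :=
  distribution P (phiX : {RV P >-> (V * off k)%type}).
have JE A : measurable A -> (N \x Q) A = J A.
  apply: product_measure_unique => B C mB mC.
  exact: independent_off.
transitivity (\int[J]_z f z).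
  by rewrite ge0_integral_distribution.
transitivity (\int[N \x Q]_z f z).
  apply: eq_measure_integral => A mA _; exact/esym/JE.
rewrite fubini_tonelli2// ge0_integral_distribution//.
- exact: measurable_fun_fubini_tonelli_G.
- by move=> y; exact: integral_ge0.
Qed.
End independence.

(** * Eliminating one variable of a quadratic form *)

Section elimination.
Variable R : realType.

Lemma qform_col_mx m (B : 'M[R]_(1 + m)) (x0 : R) (y : 'cV[R]_m) :
  B^T = B ->
  qform B (col_mx x0%:M y) =
  ulsubmx B 0 0 * x0 ^+ 2 + 2 * x0 * (ursubmx B *m y) 0 0 + qform (drsubmx B) y.
Proof.
move=> Bsym; have BE := submxK B.
have dlE : dlsubmx B = (ursubmx B)^T by rewrite trmx_ursub Bsym.
rewrite /qform -{1}BE dlE tr_col_mx mul_row_block mul_row_col.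
rewrite [ulsubmx B]mx11_scalar tr_scalar_mx mul_scalar_mx scale_scalar_mx.
rewrite -trmx_mul mul_scalar_mx !mulmxDl mul_mx_scalar mul_mx_scalar.
rewrite -!scalemxAl !mxE /= !mulr1n.
ring.
Qed.

Lemma norm2_col_mx m (x0 : R) (y : 'cV[R]_m) :
  norm2 (col_mx x0%:M y) ^+ 2 = x0 ^+ 2 + norm2 y ^+ 2.
Proof.
rewrite !norm2_sqr big_split_ord big_ord1 /= col_mxEu mxE mulr1n; congr (_ + _).
by apply: eq_bigr => i _; rewrite col_mxEd.
Qed.

(** The matrix of the quadratic form that remains after the first Gaussian variable
    has been integrated out; [1 - eliminate B] is the Schur complement of the
    upper left entry of [1 - B]. *)
Definition eliminate m (B : 'M[R]_(1 + m)) : 'M[R]_m :=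
  drsubmx B + (1 - ulsubmx B 0 0)^-1 *: ((ursubmx B)^T *m ursubmx B).

Lemma qform_eliminate m (B : 'M[R]_(1 + m)) (y : 'cV[R]_m) :
  qform (eliminate B) y =
  qform (drsubmx B) y + (ursubmx B *m y) 0 0 ^+ 2 / (1 - ulsubmx B 0 0).
Proof.
rewrite /qform mulmxDr mulmxDl [LHS]mxE; congr (_ + _).
rewrite -scalemxAr -scalemxAl [LHS]mxE mulmxA -[_ *m _ *m y]mulmxA -trmx_mul.
rewrite [X in _ * X]mxE big_ord1.
by rewrite [_^T _ _]mxE -expr2 mulrC.
Qed.

Lemma eliminate_sym m (B : 'M[R]_(1 + m)) :
  B^T = B -> (eliminate B)^T = eliminate B.
Proof.
move=> Bsym; rewrite /eliminate linearD/= linearZ/= trmx_mul trmxK.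
by rewrite trmx_drsub Bsym.
Qed.

(** Column operations, that is multiplication by the unipotent [U], clear the
    upper right block of [1 - B]. *)
Lemma det_eliminate m (B : 'M[R]_(1 + m)) : B^T = B -> ulsubmx B 0 0 < 1 ->
  \det (1%:M - B) = (1 - ulsubmx B 0 0) * \det (1%:M - eliminate B).
Proof.
move=> Bsym b1; have BE := submxK B; set b := ulsubmx B 0 0 in b1 *.
have dlE : dlsubmx B = (ursubmx B)^T by rewrite trmx_ursub Bsym.
set r := ursubmx B in BE dlE *; set D := drsubmx B in BE *.
have b0 : 1 - b != 0 by rewrite subr_eq0 eq_sym lt_eqF.
have E1 : 1%:M - B = block_mx (1 - b)%:M (- r) (- r^T) (1%:M - D).
  rewrite -BE dlE [ulsubmx B]mx11_scalar -/b scalar_mx_block opp_block_mx.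
  by rewrite add_block_mx !add0r raddfB.
pose U : 'M[R]_(1 + m) := block_mx 1%:M ((1 - b)^-1 *: r) 0 1%:M.
have detU : \det U = 1 by rewrite det_ublock !det1 mulr1.
have -> : \det (1%:M - B) = \det ((1%:M - B) *m U) by rewrite det_mulmx detU mulr1.
rewrite E1 mulmx_block !mulmx0 !mulmx1 !addr0.
rewrite -scalemxAr -scalar_mxC mul_mx_scalar scalerA mulVf// scale1r subrr.
rewrite det_lblock det_scalar1; congr (_ * \det _).
by rewrite /eliminate -/D -/r -/b mulNmx -scalemxAr opprD addrC -addrA.
Qed.

(** Positive definiteness of [1 - B] passes to the Schur complement. *)
Lemma eliminate_lt_norm2 m (B : 'M[R]_(1 + m)) : B^T = B ->
  (forall x, x != 0 -> qform B x < norm2 x ^+ 2) ->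
  ulsubmx B 0 0 < 1 /\
  (forall y, y != 0 -> qform (eliminate B) y < norm2 y ^+ 2).
Proof.
move=> Bsym Bpos; set b := ulsubmx B 0 0.
have b1 : b < 1.
  have := Bpos (col_mx 1%:M 0); rewrite qform_col_mx// norm2_col_mx -/b.
  have -> : norm2 (0 : 'cV[R]_m) = 0 by apply/eqP; rewrite norm2_eq0.
  rewrite mulmx0 mxE /qform mulmx0 mxE expr1n expr0n mulr0 !addr0 mulr1; apply.
  by rewrite -norm2_eq0 -sqrf_eq0 norm2_col_mx expr1n paddr_eq0 ?sqr_ge0// oner_eq0.
split=> // y y0; rewrite qform_eliminate -/b; set c := (_ *m _) 0 0.
(* This first coordinate minimizes the form of [1 - B] when the others are [y]. *)
have := Bpos (col_mx (c / (1 - b))%:M y); rewrite qform_col_mx// norm2_col_mx -/b -/c.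
have : norm2 y ^+ 2 != 0 by rewrite sqrf_eq0 norm2_eq0.
set q := qform _ _; set ny := norm2 y ^+ 2 => ny0 h.
have {}h : b * (c / (1 - b)) ^+ 2 + 2 * (c / (1 - b)) * c + q <
    (c / (1 - b)) ^+ 2 + ny.
  apply: h; rewrite -norm2_eq0 -sqrf_eq0 norm2_col_mx paddr_eq0 ?sqr_ge0//.
  by rewrite (negbTE ny0) andbF.
rewrite -subr_gt0 in h; rewrite -subr_gt0; apply: lt_le_trans h _.
rewrite le_eqVlt; apply/orP; left; apply/eqP; field.
by rewrite subr_eq0 eq_sym lt_eqF.
Qed.

End elimination.

(** * Exponential moments of a Gaussian quadratic form *)

Section gaussian.
Context d (T : measurableType d) (R : realType) (P : probability T R).
Variables (I : finType) (X : I -> {RV P >-> R}).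
Hypothesis indep : mutually_independent X.
Hypothesis X_std : forall i, standard_normal (X i).
Local Notation off k := (g_sigma_algebraType (cylinders_off X k)).

Lemma integrate_out_expR k (a : R) (b h : T -> R) : a < 1 ->
  measurable_fun setT (b : off k -> R) -> measurable_fun setT (h : off k -> R) ->
  (forall t, 0 <= h t) ->
  (\int[P]_t (expR (a / 2 * X k t ^+ 2 + b t * X k t) * h t)%:E =
   ((Num.sqrt (1 - a))^-1)%:E *
   \int[P]_t (expR (b t ^+ 2 / (1 - a) / 2) * h t)%:E)%E.
Proof.
move=> a1 mb mh h0.
pose f (z : measurableTypeR R * off k) :=
  (expR (a / 2 * z.1 ^+ 2 + b z.2 * z.1) * h z.2)%:E.
have mfst : measurable_fun setT (fun z : measurableTypeR R * off k => z.1 : R).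
  exact: measurable_fst.
have mb2 : measurable_fun setT (fun z : measurableTypeR R * off k => b z.2).
  exact: (measurableT_comp mb measurable_snd).
have mh2 : measurable_fun setT (fun z : measurableTypeR R * off k => h z.2).
  exact: (measurableT_comp mh measurable_snd).
have mf : measurable_fun setT f.
  apply/measurable_EFinP; apply: measurable_funM => //.
  apply: measurableT_comp => //; apply: measurable_funD; last exact: measurable_funM.
  by apply: measurable_funM => //; exact: measurable_funX.
have f0 z : (0 <= f z)%E by rewrite lee_fin mulr_ge0 ?expR_ge0.
rewrite (integrate_out indep X_std mf f0).
have mexp : measurable_fun setT (fun t => expR (b t ^+ 2 / (1 - a) / 2) * h t : R).
  apply: measurable_funM; last exact: measurable_fun_off mh.
  apply: measurableT_comp => //; apply: measurable_funM => //.
  apply: measurable_funM => //; apply: measurable_funX.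
  exact: measurable_fun_off mb.
rewrite -ge0_integralZl//.
- apply: eq_integral => t _; rewrite /f /=.
  under eq_integral do rewrite EFinM.
  rewrite ge0_integralZr//.
  + by rewrite integral_normal_expR// -!EFinM mulrA.
  + apply/measurable_EFinP; apply: measurableT_comp => //.
    apply: measurable_funD.
      by apply: measurable_funM => //; exact: measurable_funX.
    exact: measurable_funM.
  + by rewrite lee_fin.
- exact/measurable_EFinP.
- by move=> t _; rewrite lee_fin mulr_ge0 ?expR_ge0.
Qed.

Lemma measurable_qform d' (U : measurableType d') m (B : 'M[R]_m)
    (x : 'I_m -> U -> R) : (forall j, measurable_fun setT (x j)) ->
  measurable_fun setT (fun t => qform B (\col_j x j t)).
Proof.
move=> mx; rewrite (_ : (fun _ => _) =
    (fun t => \sum_j (\sum_i x i t * B i j) * x j t)).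
  apply: measurable_sum => j; apply: measurable_funM => //.
  by apply: measurable_sum => i; exact: measurable_funM.
apply/funext => t; rewrite /qform mxE; apply: eq_bigr => j _; rewrite !mxE.
by congr (_ * _); apply: eq_bigr => i _; rewrite !mxE.
Qed.

(** The factor [h], which depends only on variables outside the range of [idx], is
    what makes the induction go through; it also lets several independent vectors be
    treated in turn. *)
Lemma integrate_out_qform m (B : 'M[R]_m) (idx : 'I_m -> I) (h : T -> R) :
  B^T = B -> (forall x, x != 0 -> qform B x < norm2 x ^+ 2) ->
  injective idx -> (forall t, 0 <= h t) ->
  (forall j, measurable_fun setT (h : off (idx j) -> R)) ->
  (\int[P]_t (expR (qform B (\col_j X (idx j) t) / 2) * h t)%:E =
   ((Num.sqrt (\det (1%:M - B)))^-1)%:E * \int[P]_t (h t)%:E)%E.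
Proof.
elim: m B idx h => [|m IH] B idx h Bsym Bpos idx_inj h0 mh.
  rewrite det_mx00 sqrtr1 invr1 mul1e; apply: eq_integral => t _.
  by rewrite /qform mxE big_ord0 mul0r expR0 mul1r.
rewrite -[m.+1]/(1 + m)%N in B idx Bsym Bpos idx_inj mh *.
have [b1 Epos] := eliminate_lt_norm2 Bsym Bpos.
pose k := idx (lshift m 0); pose idx' (j : 'I_m) := idx (rshift 1 j).
pose y t : 'cV[R]_m := \col_j X (idx' j) t.
have idx'k j : idx' j != k by rewrite (inj_eq idx_inj) -val_eqE.
have colE t : \col_j X (idx j) t = col_mx (X k t)%:M (y t).
  apply/matrixP => i j; rewrite [j]ord1 !mxE; case: splitP => i' ii'.
    rewrite [i']ord1 !mxE mulr1n; congr (X (idx _) t); apply: val_inj.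
    by rewrite /= ii' [i']ord1.
  by rewrite !mxE; congr (X (idx _) t); apply: val_inj.
pose g t := expR (qform (drsubmx B) (y t) / 2) * h t.
pose c t := (ursubmx B *m y t) 0 0.
have mX j : measurable_fun setT (X (idx' j) : off k -> R) by exact: measurable_off.
have mg : measurable_fun setT (g : off k -> R).
  apply: measurable_funM; last exact: mh.
  apply: measurableT_comp => //; apply: measurable_funM => //.
  exact: (@measurable_qform _ (off k) _ _ (fun j => X (idx' j))).
have mc : measurable_fun setT (c : off k -> R).
  rewrite (_ : c = fun t => \sum_j ursubmx B 0 j * X (idx' j) t).
    by apply: measurable_sum => j; exact: measurable_funM.
  by apply/funext => t; rewrite /c mxE; apply: eq_bigr => j _; rewrite !mxE.
have g0 t : 0 <= g t by rewrite mulr_ge0 ?expR_ge0.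
transitivity (\int[P]_t
    (expR (ulsubmx B 0 0 / 2 * X k t ^+ 2 + c t * X k t) * g t)%:E)%E.
  apply: eq_integral => t _; rewrite colE qform_col_mx// /g mulrA -expRD.
  by congr (expR _ * _)%:E; rewrite /c; field.
rewrite integrate_out_expR//.
transitivity (((Num.sqrt (1 - ulsubmx B 0 0))^-1)%:E *
    \int[P]_t (expR (qform (eliminate B) (y t) / 2) * h t)%:E)%E.
  congr (_ * _)%E; apply: eq_integral => t _; rewrite qform_eliminate /g.
  by rewrite mulrA -expRD; congr (expR _ * _)%:E; rewrite /c mulrDl addrC.
rewrite IH//.
- rewrite muleA -EFinM -invfM det_eliminate// sqrtrM// subr_ge0 ltW//.
- exact: eliminate_sym.
- by move=> i j /idx_inj /rshift_inj.
- by move=> j; exact: mh.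
Qed.

End gaussian.

(** * Tail bounds for the trace estimator *)

(** For [0 <= u], 1 + v <= exp v at v = u + u^2 only gives
    1 - u^3 <= (1 - u) exp(u + u^2), which falls just short; hence the sharper
    lower bound [(1 + u / 4) ^+ 4] of [expR u] in that case. *)
Lemma expR_le_1Bx (R : realType) (u : R) :
  `|u| <= 2^-1 -> expR (- (u + u ^+ 2)) <= 1 - u.
Proof.
rewrite ler_norml => /andP[u1 u2].
have u3 : 0 < 1 - u by lra.
rewrite expRN -[leRHS]invrK lef_pV2 ?posrE ?invr_gt0 ?expR_gt0//.
rewrite -div1r ler_pdivrMr//.
have [u0|u0] := leP 0 u.
  have e4 : (1 + u / 4) ^+ 4 <= expR u.
    rewrite [in leRHS](_ : u = u / 4 * 4%:R); last by field.
    by rewrite expRM_natr lerXn2r ?nnegrE ?expR_ge0 ?expR_ge1Dx//; lra.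
  have e1 : 1 + u ^+ 2 <= expR (u ^+ 2) by exact: expR_ge1Dx.
  have e5 : (1 + u / 4) ^+ 4 * (1 + u ^+ 2) <= expR (u + u ^+ 2).
    by rewrite expRD ler_pM// ?addr_ge0 ?exprn_ge0 ?sqr_ge0//; lra.
  apply: le_trans (_ : _ <= (1 + u / 4) ^+ 4 * (1 + u ^+ 2) * (1 - u)) _; last first.
    by rewrite ler_pM2r.
  have pow k : u ^+ k <= 2^-1 ^+ k by rewrite lerXn2r// nnegrE//; lra.
  have := pow 2; have := pow 3; have := pow 4; have := pow 5 => p5 p4 p3 p2.
  have u20 : 0 <= u ^+ 2 by exact: sqr_ge0.
  rewrite -subr_ge0.
  have -> : (1 + u / 4) ^+ 4 * (1 + u ^+ 2) * (1 - u) - 1 =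
    u ^+ 2 * (3 / 8 - 5 / 16 * u - 175 / 256 * u ^+ 2 - 81 / 256 * u ^+ 3
      - 15 / 256 * u ^+ 4 - 1 / 256 * u ^+ 5).
    by field.
  apply: mulr_ge0 => //; lra.
have h := expR_ge1Dx (u + u ^+ 2).
apply: (@le_trans _ _ ((1 + (u + u ^+ 2)) * (1 - u))); last by rewrite ler_pM2r.
nra.
Qed.

Section sample.
Context d (T : measurableType d) (R : realType) (P : probability T R).
Variables (N n : nat) (w : 'I_N -> 'I_n -> {RV P >-> R}).
Hypothesis w_iid : iid_standard_normal w.

Let X (k : 'I_N * 'I_n) : {RV P >-> R} := w k.1 k.2.

Lemma integral_prod_expR_qform (B : 'M[R]_n) (l : seq 'I_N) :
  B^T = B -> (forall x, x != 0 -> qform B x < norm2 x ^+ 2) -> uniq l ->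
  (\int[P]_t (\prod_(i <- l) expR (qform B (\col_j w i j t) / 2))%:E =
   ((Num.sqrt (\det (1%:M - B)))^-1 ^+ size l)%:E)%E.
Proof.
move=> Bsym Bpos; elim: l => [_|i l IH /= /andP[il ul]].
  under eq_integral do rewrite big_nil.
  by rewrite integral_cst//= mul1e probability_setT.
under eq_integral do rewrite big_cons.
have [w_std w_indep] := w_iid.
rewrite (@integrate_out_qform _ _ _ P _ X w_indep _ _ B (fun j => (i, j)))//.
- by rewrite IH// -EFinM exprS.
- by case=> i' j'; exact: w_std.
- by move=> j k [].
- by move=> t; apply: prodr_ge0 => i' _; exact: expR_ge0.
- move=> j; apply: measurable_prod => i' i'l.
  apply: measurableT_comp => //; apply: measurable_funM => //.
  apply: (@measurable_qform R _ (g_sigma_algebraType (cylinders_off X (i, j)))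
    _ B (fun j' => X (i', j'))) => j'.
  apply: measurable_off; apply: contraNneq il => -[<- _] //.
Qed.

Definition total_qform (A : 'M[R]_n) t := \sum_(i < N) qform A (\col_j w i j t).

Lemma measurable_total_qform A : measurable_fun setT (total_qform A).
Proof.
apply: measurable_sum => i.
exact: (@measurable_qform R _ T _ A (fun j => w i j)).
Qed.

Variables (A : 'M[R]_n) (lam : 'I_n -> R).
Hypotheses (A_sym : A \is symmetricmx) (lamP : is_eigenvalues A lam).
Hypotheses (A_psd : psdmx A).

(** The bound [`|2 * s| * K <= 2^-1] makes [1 - 2 s A] positive definite and puts
    every [2 * s * lam j] in the range of [expR_le_1Bx]. *)
Lemma integral_expR_total_qform s K : 0 < K -> (forall j, lam j <= K) ->
  `|2 * s| * K <= 2^-1 ->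
  (\int[P]_t (expR (s * total_qform A t))%:E <=
   (expR (N%:R * \sum_j (s * lam j + 2 * s ^+ 2 * lam j ^+ 2)))%:E)%E.
Proof.
move=> K0 lamK sK; have lam0 j : 0 <= lam j by exact: (eigen_ge0 A_sym lamP).
have AT := symmetricmx_tr A_sym.
have lamK2 j : 0 <= lam j <= K by rewrite lam0 lamK.
have qZ x : qform ((2 * s) *: A) x = 2 * s * qform A x.
  by rewrite /qform -scalemxAr -scalemxAl mxE.
have Bpos x : x != 0 -> qform ((2 * s) *: A) x < norm2 x ^+ 2.
  move=> x0; rewrite qZ.
  have nx : 0 < norm2 x ^+ 2 by rewrite exprn_gt0// lt_def norm2_eq0 x0 norm2_ge0.
  have := eigen_qform_le A_sym lamP x K0 lamK2; have := A_psd x => q0 qK.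
  apply: (@le_lt_trans _ _ (`|2 * s| * (K * norm2 x ^+ 2))).
    apply: (@le_trans _ _ (`|2 * s| * qform A x)).
      by rewrite ler_wpM2r ?ler_norm.
    by rewrite ler_wpM2l.
  rewrite mulrA; apply: (@le_lt_trans _ _ (2^-1 * norm2 x ^+ 2)); last lra.
  by rewrite ler_pM2r.
have -> : (\int[P]_t (expR (s * total_qform A t))%:E =
  \int[P]_t (\prod_(i <- index_enum 'I_N)
     expR (qform ((2 * s) *: A) (\col_j w i j t) / 2))%:E)%E.
  apply: eq_integral => t _; rewrite -expR_sum; congr (expR _)%:E.
  by rewrite /total_qform mulr_sumr; apply: eq_bigr => i _; rewrite qZ; field.
rewrite integral_prod_expR_qform ?index_enum_uniq//; last by rewrite linearZ/= AT.
rewrite lee_fin /index_enum -enumT size_enum_ord expRM_natl lerXn2r ?nnegrE//.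
have u_le j : `|2 * s * lam j| <= 2^-1.
  by apply: le_trans sK; rewrite normrM ler_wpM2l// ger0_norm.
have det_ge : expR (\sum_j (s * lam j + 2 * s ^+ 2 * lam j ^+ 2)) ^- 2 <=
    \det (1%:M - (2 * s) *: A).
  rewrite (det_eigen lamP) -expRM_natl -expRN -mulrN -sumrN mulr_sumr expR_sum.
  apply: ler_prod => j _; rewrite expR_ge0/=.
  have -> : 2%:R * - (s * lam j + 2 * s ^+ 2 * lam j ^+ 2) =
    - (2 * s * lam j + (2 * s * lam j) ^+ 2) by ring.
  exact: expR_le_1Bx.
set E := expR _ in det_ge *; have E0 : 0 < E by exact: expR_gt0.
have det_gt0 : 0 < \det (1%:M - (2 * s) *: A).
  by apply: lt_le_trans det_ge; rewrite invr_gt0 exprn_gt0.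
rewrite -[leRHS]invrK lef_pV2 ?posrE ?invr_gt0// ?sqrtr_gt0//.
rewrite -[leLHS]gtr0_norm ?invr_gt0// -sqrtr_sqr ler_sqrt ?exprVn//.
exact: ltW.
Qed.

(** The sign [c] selects the upper tail ([c = 1]) or the lower one ([c = -1]).  The
    parameter r = eps / (4 K) minimizes the exponent N (- r eps + 2 r^2 K) tr A. *)
Lemma chernoff_total_qform c K eps : 0 < K -> (forall j, lam j <= K) ->
  0 < eps < 1 -> `|c| = 1 ->
  (P [set t | (N%:R * ((c + eps) * \tr A) <= c * total_qform A t)%R] <=
   (expR (- (N%:R * (eps ^+ 2 * \tr A / (8 * K)))))%:E)%E.
Proof.
move=> K0 lamK /andP[eps0 eps1] c1.
have lam0 j : 0 <= lam j by exact: (eigen_ge0 A_sym lamP).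
have c2 : c ^+ 2 = 1 by rewrite -[c ^+ 2]ger0_norm ?sqr_ge0// normrX c1 expr1n.
pose Y t := c * total_qform A t.
have mY : measurable_fun setT Y.
  by apply: measurable_funM => //; exact: measurable_total_qform.
pose Ymix := isMeasurableFun.Build _ _ _ _ _ mY.
pose YR : {RV P >-> R} := HB.pack Y Ymix.
have [r rE] : exists r, r = eps / (4 * K) by eexists.
have r0 : 0 < r by rewrite rE divr_gt0// mulr_gt0.
apply: (le_trans (chernoff YR (N%:R * ((c + eps) * \tr A)) r0)).
have mgf : ('M_P YR r <= (expR (N%:R * \sum_j (r * c * lam j +
    2 * (r * c) ^+ 2 * lam j ^+ 2)))%:E)%E.
  rewrite /mmt_gen_fun unlock.
  have -> : (\int[P]_t ((expR \o r \o* YR) t)%:E =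
      \int[P]_t (expR (r * c * total_qform A t))%:E)%E.
    by apply: eq_integral => t _; congr (expR _)%:E; rewrite /= /Y; ring.
  apply: (integral_expR_total_qform K0 lamK).
  rewrite mulrA normrM c1 mulr1 gtr0_norm ?mulr_gt0// rE.
  have -> : 2 * (eps / (4 * K)) * K = eps / 2 by field; rewrite gt_eqF.
  lra.
apply: le_trans (lee_wpmul2r _ mgf) _; first by rewrite lee_fin expR_ge0.
rewrite -EFinM lee_fin -expRD ler_expR.
have sqK : \sum_j lam j ^+ 2 <= K * \tr A.
  rewrite (trace_eigen lamP) mulr_sumr; apply: ler_sum => j _.
  by rewrite expr2 ler_wpM2r.
rewrite big_split/= -!mulr_sumr -(trace_eigen lamP) exprMn c2 mulr1.
apply: (@le_trans _ _ (N%:R * (r * c * \tr A + 2 * r ^+ 2 * (K * \tr A)) +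
    - (r * (N%:R * ((c + eps) * \tr A))))).
  by rewrite lerD2r ler_wpM2l// lerD2l ler_wpM2l// mulr_ge0// sqr_ge0.
rewrite le_eqVlt; apply/orP; left; apply/eqP; rewrite rE; field.
by rewrite gt_eqF.
Qed.

Lemma estimatorE t : gaussian_trace_estimator w A t = total_qform A t / N%:R.
Proof. by rewrite mulrC. Qed.

(** Union bound over the two tails, each of probability at most [delta / 2]. *)
Lemma estimator_concentration K eps delta : (0 < N)%N -> 0 < K ->
  (forall j, lam j <= K) -> 0 < \tr A -> 0 < eps < 1 -> 0 < delta ->
  8 * (K / \tr A) * eps ^- 2 * ln (2 / delta) <= N%:R ->
  ((1 - delta)%:E <= P [set t | (`|gaussian_trace_estimator w A t - \tr A|
                                <= eps * \tr A)%R])%E.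
Proof.
move=> N0 K0 lamK tr0 eps01 delta0 NK; have /andP[eps0 eps1] := eps01.
have NR0 : 0 < N%:R :> R by rewrite ltr0n.
set E := [set t | _].
have mest : measurable_fun setT (gaussian_trace_estimator w A).
  by apply: measurable_funM => //; exact: measurable_total_qform.
have mtail c a : d.-measurable [set t | a <= c * total_qform A t].
  rewrite -[X in measurable X]setTI.
  apply: (@measurable_fun_le _ _ _ setT) => //.
  by apply: measurable_funM => //; exact: measurable_total_qform.
have mE : d.-measurable E.
  rewrite -[X in measurable X]setTI; apply: (@measurable_fun_le _ _ _ setT) => //.
  by apply: measurableT_comp => //; exact: measurable_funB.
pose L c := [set t | N%:R * ((c + eps) * \tr A) <= c * total_qform A t].
have PL c : `|c| = 1 -> (P (L c) <= (delta / 2)%:E)%E.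
  move=> c1; apply: (le_trans (chernoff_total_qform K0 lamK eps01 c1)).
  rewrite lee_fin -[delta / 2]invrK invf_div expRN lef_pV2 ?posrE ?expR_gt0 ?divr_gt0//.
  rewrite -[leLHS]lnK ?posrE ?divr_gt0// ler_expR.
  move: NK; rewrite -ler_pdivlMl ?mulr_gt0 ?divr_gt0 ?invr_gt0 ?exprn_gt0//.
  move=> /le_trans; apply; rewrite le_eqVlt; apply/orP; left; apply/eqP.
  by field; rewrite !gt_eqF.
have EL : ~` E `<=` L 1 `|` L (-1).
  move=> t /= /negP; rewrite -ltNge estimatorE ltr_normr /L /=.
  have SE : total_qform A t = N%:R * (total_qform A t / N%:R).
    by rewrite mulrCA mulfV ?mulr1// gt_eqF.
  move: SE; set q := total_qform A t / N%:R => ->.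
  by move=> /orP[] h; [left|right]; rewrite [leRHS]mulrCA ler_pM2l//; lra.
have : (P (~` E) <= delta%:E)%E.
  apply: (@le_trans _ _ (P (L 1 `|` L (-1)))).
    apply: le_measure => //; rewrite inE; first exact: measurableC.
    exact: measurableU (mtail _ _) (mtail _ _).
  apply: le_trans (measureU2 _ _ _) _; [exact: mtail|exact: mtail|].
  have -> : delta = delta / 2 + delta / 2 by field.
  by rewrite EFinD leeD// PL// ?normrN normr1.
rewrite probability_setC// -(@fineK _ (P E)) ?fin_num_measure//.
by rewrite -EFinB !lee_fin => ?; lra.
Qed.

End sample.

(** * Concentration of the Gaussian trace estimator *)

Theorem theorem3 (R : realType) (n : nat) (A : 'M[R]_n) (lam : 'I_n -> R)
    (A_neq0 : A != 0) (A_sym : A \is symmetricmx) (A_psd : psdmx A)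
    (lamP : is_eigenvalues A lam) :
  KG A lam = spectral_norm A / \tr A /\
  forall (d : measure_display) (T : measurableType d) (P : probability T R)
    (N : nat) (w : 'I_N -> 'I_n -> {RV P >-> R}) (eps delta : R),
    (0 < N)%N -> iid_standard_normal w ->
    0 < eps < 1 -> 0 < delta < 1 ->
    (8 * eps ^- 2 * ln (2 / delta) <= N%:R ->
      ((1 - delta)%:E <=
        P [set t | (`|gaussian_trace_estimator w A t - \tr A|
                     <= eps * \tr A)%R])%E) /\
    (8 * KG A lam * eps ^- 2 * ln (2 / delta) < N%:R ->
      ((1 - delta)%:E <=
        P [set t | (`|gaussian_trace_estimator w A t - \tr A|
                     <= eps * \tr A)%R])%E).
Proof.
have tr0 := trace_gt0 A_sym lamP A_psd A_neq0.
have KGE := KG_bigmax A_sym lamP A_psd A_neq0.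
split; first by rewrite KGE (spectral_norm_bigmax A_sym lamP A_psd).
move=> d T P N w eps delta N0 w_iid eps01 /andP[delta0 delta1].
have lam0 j : 0 <= lam j by exact: (eigen_ge0 A_sym lamP).
set K := \big[Num.max/0]_j lam j in KGE.
have lamK j : lam j <= K by rewrite le_bigmax.
have KA : K <= \tr A.
  rewrite (trace_eigen lamP); apply: bigmax_le; first exact: sumr_ge0.
  by move=> j _; rewrite (bigD1 j)//= lerDl sumr_ge0.
have K0 : 0 < K.
  rewrite ltNge; apply/negP => K_le0; move: tr0; rewrite ltNge => /negP; apply.
  by rewrite (trace_eigen lamP) sumr_le0// => j _; exact: le_trans K_le0.
have main : 8 * KG A lam * eps ^- 2 * ln (2 / delta) <= N%:R ->
    ((1 - delta)%:E <= P [set t | (`|gaussian_trace_estimator w A t - \tr A|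
                                   <= eps * \tr A)%R])%E.
  rewrite KGE.
  exact: (estimator_concentration w_iid A_sym lamP A_psd N0 K0 lamK tr0).
split=> NK; apply: main; last exact: ltW.
apply: le_trans NK; rewrite ler_wpM2r//.
  by rewrite ln_ge0// ler_pdivlMr// mul1r; lra.
rewrite ler_wpM2r ?invr_ge0 ?sqr_ge0// ger_pMr//.
by rewrite KGE ler_pdivrMr// mul1r.
Qed.
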